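(* Let $R$ be a maximal subring of a ring $T$ and $T=R\oplus I$, where $I$ is an ideal of $T$. Then either $J(T)\cap R=J(R)$ or the following hold: (1) $I^2=I$. (2) $J(T)\subseteq (R:T)=(R:T)_l=(R:T)_r$. (3) $TJ(R)=J(R)T\nsubseteq R$; in particular, $(R:T)$ is not a left/right primitive ideal of $R$ and hence $dim(R)\geq 1$. Moreover, $IJ(R)=J(R)I=I$, and neither ${}_RI$ nor $I_R$ has maximal submodules. (4) $J({}_RT)$ and $J(T_R)$ are proper submodules of $T$ and contain $I$. (5) $(R:T)=l.ann_T(I)$ is a primitive and a minimal prime ideal of $T$. (6) $(R:T)$ is not a maximal ideal of $T$. Moreover, $(R:T)\oplus I$ is a prime ideal of $T$ which is not maximal. In particular, $dim(T)\geq 2$. (7) $I$ is contained in each maximal ideal of $T$. (8) $I$ is unique, i.e., if $I_1$ is a nonzero proper ideal of $T$ such that $R\cap I_1=0$, then $I_1=I$.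
   Context: All rings are associative and unital (not necessarily commutative), and subrings contain the identity of the big ring; ''ideal'' means two-sided ideal. A maximal subring $R$ of $T$ is a proper subring with no subring strictly between $R$ and $T$. $T=R\oplus I$ means $T=R+I$ and $R\cap I=0$. $J(R)$, $J(T)$ are Jacobson radicals of the rings; $J({}_RT)$, $J(T_R)$ are the radicals of $T$ as left, right $R$-module (the intersection of all maximal submodules, equal to $T$ if there are none). Conductors: $(R:T)=\{x\in T: TxT\subseteq R\}$, $(R:T)_l=\{x\in T: Tx\subseteq R\}$, $(R:T)_r=\{x\in T: xT\subseteq R\}$. $l.ann_T(I)=\{t\in T: tI=0\}$. A primitive ideal is one that is both left and right primitive. $dim$ denotes the classical Krull dimension, i.e. the supremum of lengths of chains of prime ideals. *)

(* Defs.v *)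
From mathcomp Require Import all_boot all_order all_algebra.
From mathcomp Require Import boolp classical_sets constructive_ereal.

Set Implicit Arguments.
Unset Strict Implicit.
Unset Printing Implicit Defensive.

Import Order.TTheory GRing.Theory Num.Theory.

Local Open Scope classical_set_scope.
Local Open Scope ring_scope.

(* All the rings that occur (T itself and its subrings) are represented by      *)
(* their carriers, as sets S : set T in an ambient ring T; T is [set: T].  The  *)
(* ring-theoretic notions below take that carrier S as an argument and are      *)
(* meaningful when subring S holds.                                             *)

Section Rings.
Variable T : pzRingType.
Implicit Types A B C I K M N P S X Y : set T.

Definition subring S : Prop := GRing.subring_closed [in S].

(* A + B *)
Definition sumset A B : set T := [set a + b | a in A & b in B].

(* A B: the finite sums of products, not the set of the products *)
Definition mulset A B : set T :=
  [set x | exists n (a b : 'I_n -> T),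
     [/\ forall i, A (a i), forall i, B (b i) & x = \sum_(i < n) a i * b i]].

(* M = A (+) B, internally *)
Definition direct_sum A B M : Prop := sumset A B = M /\ A `&` B = [set 0].

Definition left_submodule S M N : Prop :=
  [/\ N `<=` M, GRing.zmod_closed [in N]
    & forall s x, S s -> N x -> N (s * x)].

Definition right_submodule S M N : Prop :=
  [/\ N `<=` M, GRing.zmod_closed [in N]
    & forall x s, N x -> S s -> N (x * s)].

Definition ideal S N : Prop := left_submodule S S N /\ right_submodule S S N.

(* N is maximal among the members of the family F other than M *)
Definition maximal_in (F : set (set T)) M N : Prop :=
  [/\ F N, N <> M & forall K, F K -> N `<=` K -> K = N \/ K = M].

Definition maximal_subring S : Prop := maximal_in subring [set: T] S.

Definition maximal_left_submodule S M N : Prop :=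
  maximal_in (left_submodule S M) M N.

Definition maximal_right_submodule S M N : Prop :=
  maximal_in (right_submodule S M) M N.

Definition maximal_ideal S N : Prop := maximal_in (ideal S) S N.

(* J(_S M) and J(M_S); both are M when there is no maximal submodule, since the *)
(* intersection of the empty family is [set: T].                                *)
Definition left_radical S M : set T :=
  M `&` \bigcap_(N in maximal_left_submodule S M) N.

Definition right_radical S M : set T :=
  M `&` \bigcap_(N in maximal_right_submodule S M) N.

Definition jacobson S : set T := left_radical S S.

(* (S : T), (S : T)_l, (S : T)_r *)
Definition conductor S : set T := [set x | forall t u, S (t * x * u)].
Definition left_conductor S : set T := [set x | forall t, S (t * x)].
Definition right_conductor S : set T := [set x | forall t, S (x * t)].

Definition left_ann I : set T := [set t | forall i, I i -> t * i = 0].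

Definition prime_ideal S P : Prop :=
  [/\ ideal S P, P <> S
    & forall X Y, ideal S X -> ideal S Y ->
        mulset X Y `<=` P -> X `<=` P \/ Y `<=` P].

Definition minimal_prime_ideal S P : Prop :=
  prime_ideal S P /\ forall Q : set T, prime_ideal S Q -> Q `<=` P -> Q = P.

(* An S-module is an action of T of which only the values on S matter. *)
Definition is_left_module S (M : zmodType) (act : T -> M -> M) : Prop :=
  [/\ forall m, act 1 m = m,
      forall a b m, S a -> S b -> act (a * b) m = act a (act b m),
      forall a b m, S a -> S b -> act (a + b) m = act a m + act b m
    & forall a m m', S a -> act a (m + m') = act a m + act a m'].

Definition is_right_module S (M : zmodType) (act : M -> T -> M) : Prop :=
  [/\ forall m, act m 1 = m,
      forall m a b, S a -> S b -> act m (a * b) = act (act m a) b,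
      forall m a b, S a -> S b -> act m (a + b) = act m a + act m b
    & forall m m' a, S a -> act (m + m') a = act m a + act m' a].

Definition simple_left_module S (M : zmodType) (act : T -> M -> M) : Prop :=
  [/\ is_left_module S act, [set: M] <> [set 0]
    & forall N : set M, GRing.zmod_closed [in N] ->
        (forall a m, S a -> N m -> N (act a m)) -> N = [set 0] \/ N = [set: M]].

Definition simple_right_module S (M : zmodType) (act : M -> T -> M) : Prop :=
  [/\ is_right_module S act, [set: M] <> [set 0]
    & forall N : set M, GRing.zmod_closed [in N] ->
        (forall m a, N m -> S a -> N (act m a)) -> N = [set 0] \/ N = [set: M]].

(* annihilators of simple modules *)
Definition left_primitive_ideal S P : Prop :=
  exists (M : zmodType) (act : T -> M -> M),
    simple_left_module S act /\ P = [set x | S x /\ forall m, act x m = 0].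

Definition right_primitive_ideal S P : Prop :=
  exists (M : zmodType) (act : M -> T -> M),
    simple_right_module S act /\ P = [set x | S x /\ forall m, act m x = 0].

Definition primitive_ideal S P : Prop :=
  left_primitive_ideal S P /\ right_primitive_ideal S P.

(* a chain P 0 < ... < P n of prime ideals of S has length n *)
Definition prime_chain S (n : nat) (P : nat -> set T) : Prop :=
  (forall i, (i <= n)%N -> prime_ideal S (P i)) /\
  (forall i, (i < n)%N -> P i `<` P i.+1).

(* Krull dimension, in the integers extended with +oo and -oo; it is -oo when   *)
(* S has no prime ideal.  Every subset of \bar int has a supremum.              *)
Definition krull_dim S : \bar int :=
  supremum -oo%E [set (n%:Z)%:E | n in [set n | exists P : nat -> set T, prime_chain S n P]].

End Rings.

(* Main.v *)
(* Maximality of R forces every additive subgroup K of I that is closed under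
   products and under multiplication by R on both sides to be 0 or I, since
   R + K is a subring.  In particular I is a minimal ideal of T.  If I lies in
   J(T) then so does J(R), and J(T) n R = J(R).  Otherwise J(R) is not contained
   in J(T); then I n J(T) = 0, I^2 = I, and J(R)I = I = IJ(R), because J(R)I = 0
   would make J(R) a quasi-regular right ideal of T.  The left annihilator L of
   I is contained in R: if T = R + L, then I = J(R)I is contained in J(R) + L,
   which makes I quasi-regular.  Hence L is the conductor, it is prime in R and
   in T by minimality of I, and it is not maximal in R because J(R) does not
   annihilate I.  Primes P of R lift to primes P + I of T, which gives the chains
   of primes.  The right-handed claims are the left-handed ones for the converse
   ring T^c, J(R) being left-right symmetric. *)

Require Import Defs.
From mathcomp Require Import all_boot all_order all_algebra.
From mathcomp Require Import boolp classical_sets constructive_ereal.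
From HB Require Import structures.
From mathcomp Require Import generic_quotient ring_quotient.

Import Order.TTheory GRing.Theory Num.Theory.
Local Open Scope classical_set_scope.
Local Open Scope ring_scope.

(** * Additive subgroups *)

Section AdditiveSubgroups.
Set Implicit Arguments.
Unset Strict Implicit.
Variable V : zmodType.
Implicit Types N : set V.

Lemma zmod_closedP N :
  GRing.zmod_closed [in N] <-> N 0 /\ forall x y, N x -> N y -> N (x - y).
Proof.
split=> [[N0 NB]|[N0 NB]].
  split=> [|x y Nx Ny]; first exact: set_mem.
  by apply: set_mem; apply: NB; apply: mem_set.
split=> [|x y Nx Ny]; first exact: mem_set.
by apply: mem_set; apply: NB; apply: set_mem.
Qed.

Lemma zmod0 N : GRing.zmod_closed [in N] -> N 0.
Proof. by case/zmod_closedP. Qed.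

Lemma zmodB N x y : GRing.zmod_closed [in N] -> N x -> N y -> N (x - y).
Proof. by case/zmod_closedP=> _; apply. Qed.

Lemma zmodN N x : GRing.zmod_closed [in N] -> N x -> N (- x).
Proof. by move=> zN Nx; rewrite -sub0r; apply: zmodB => //; apply: zmod0. Qed.

Lemma zmodD N x y : GRing.zmod_closed [in N] -> N x -> N y -> N (x + y).
Proof. by move=> zN Nx Ny; rewrite -[y]opprK; apply: zmodB => //; apply: zmodN. Qed.

Lemma zmod_sum N n (f : 'I_n -> V) :
  GRing.zmod_closed [in N] -> (forall i, N (f i)) -> N (\sum_(i < n) f i).
Proof.
move=> zN Nf; apply: (big_ind N) => //; first exact: zmod0.
by move=> x y; apply: zmodD.
Qed.

Lemma zmod_closed0 : GRing.zmod_closed [in [set 0 : V]].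
Proof. by apply/zmod_closedP; split=> //= x y -> ->; rewrite subrr. Qed.

Lemma zmod_closedT : GRing.zmod_closed [in [set: V]].
Proof. exact/zmod_closedP. Qed.

Lemma zmod_closedI M N : GRing.zmod_closed [in M] ->
  GRing.zmod_closed [in N] -> GRing.zmod_closed [in M `&` N].
Proof.
move=> zM zN; apply/zmod_closedP; split=> [|x y [Mx Nx] [My Ny]].
  by split; apply: zmod0.
by split; apply: zmodB.
Qed.

End AdditiveSubgroups.

(** * Subrings, ideals and the Jacobson radical *)

Section Generalities.
Set Implicit Arguments.
Unset Strict Implicit.
Variable T : pzRingType.
Implicit Types A B C M N P S X Y : set T.

Lemma subring1 S : subring S -> S 1.
Proof. by case=> S1 _ _; apply: set_mem. Qed.

Lemma subringM S x y : subring S -> S x -> S y -> S (x * y).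
Proof. by case=> _ _ SM Sx Sy; apply: set_mem; apply: SM; apply: mem_set. Qed.

Lemma subring_zmod S : subring S -> GRing.zmod_closed [in S].
Proof.
case=> S1 SB _; apply: (iffRL (zmod_closedP S)).
have SB' x y : S x -> S y -> S (x - y).
  by move=> Sx Sy; apply: set_mem; apply: SB; apply: mem_set.
split=> //; rewrite -(subrr 1); exact: (SB' _ _ (set_mem S1) (set_mem S1)).
Qed.

Lemma subringP S : S 1 -> GRing.zmod_closed [in S] ->
  (forall x y, S x -> S y -> S (x * y)) -> subring S.
Proof.
move=> S1 zS SM; split=> [|x y Sx Sy|x y Sx Sy]; apply: mem_set => //.
  by apply: zmodB => //; apply: set_mem.
by apply: SM; apply: set_mem.
Qed.

Lemma subringT : subring [set: T].
Proof. by apply: subringP => //; apply: zmod_closedT. Qed.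

Lemma sumsetP A B x : sumset A B x <-> exists a b, [/\ A a, B b & x = a + b].
Proof.
split=> [[a Aa [b Bb <-]]|[a [b [Aa Bb ->]]]]; first by exists a, b.
by exists a => //; exists b.
Qed.

Lemma sub_sumsetl A B : GRing.zmod_closed [in B] -> A `<=` sumset A B.
Proof. by move=> zB a Aa; exists a => //; exists 0; [exact: zmod0|rewrite addr0]. Qed.

Lemma sub_sumsetr A B : GRing.zmod_closed [in A] -> B `<=` sumset A B.
Proof. by move=> zA b Bb; exists 0; [exact: zmod0|exists b => //; rewrite add0r]. Qed.

Lemma zmod_sumset A B : GRing.zmod_closed [in A] ->
  GRing.zmod_closed [in B] -> GRing.zmod_closed [in sumset A B].
Proof.
move=> zA zB; apply/zmod_closedP; split.
  by apply: sub_sumsetl => //; apply: zmod0.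
move=> _ _ [a Aa [b Bb <-]] [a' Aa' [b' Bb' <-]].
by rewrite opprD addrACA; exists (a - a'); [exact: zmodB|exists (b - b') => //; exact: zmodB].
Qed.

Lemma sumset_sub A B N : GRing.zmod_closed [in N] ->
  A `<=` N -> B `<=` N -> sumset A B `<=` N.
Proof. by move=> zN AN BN _ [a /AN Na [b /BN Nb <-]]; apply: zmodD. Qed.

Lemma mem_mulset A B a b : A a -> B b -> mulset A B (a * b).
Proof. by move=> Aa Bb; exists 1%N, (fun=> a), (fun=> b); rewrite big_ord1. Qed.

Lemma mulset_sub A B N : GRing.zmod_closed [in N] ->
  (forall a b, A a -> B b -> N (a * b)) -> mulset A B `<=` N.
Proof.
by move=> zN NM _ [n [a [b [Aa Bb ->]]]]; apply: zmod_sum => // i; apply: NM.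
Qed.

(** For a difference the two sums are concatenated, the minus sign being absorbed by the left
    factors. *)
Lemma zmod_mulset A B : GRing.zmod_closed [in A] -> GRing.zmod_closed [in mulset A B].
Proof.
move=> zA; apply/zmod_closedP; split.
  by exists 0%N, (fun=> 0), (fun=> 0); split=> [[]|[]|] //; rewrite big_ord0.
move=> _ _ [n [a [b [Aa Bb ->]]]] [m [a' [b' [Aa' Bb' ->]]]].
exists (n + m)%N.
exists (fun i => match split i with inl j => a j | inr j => - a' j end).
exists (fun i => match split i with inl j => b j | inr j => b' j end).
split=> [i|i|]; [by case: (split i) => j //; apply: zmodN|by case: (split i)|].
rewrite big_split_ord /= -sumrN; congr (_ + _); apply: eq_bigr => i _.
  by rewrite (unsplitK (inl i)).
by rewrite (unsplitK (inr i)) mulNr.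
Qed.

Lemma mulset_mull A B s : (forall a, A a -> A (s * a)) ->
  forall x, mulset A B x -> mulset A B (s * x).
Proof.
move=> sA _ [n [a [b [Aa Bb ->]]]]; exists n, (fun i => s * a i), b.
split=> // [i|]; first exact: sA.
by rewrite mulr_sumr; apply: eq_bigr => i _; rewrite mulrA.
Qed.

Lemma mulset_mulr A B s : (forall b, B b -> B (b * s)) ->
  forall x, mulset A B x -> mulset A B (x * s).
Proof.
move=> Bs _ [n [a [b [Aa Bb ->]]]]; exists n, a, (fun i => b i * s).
split=> // [i|]; first exact: Bs.
by rewrite mulr_suml; apply: eq_bigr => i _; rewrite mulrA.
Qed.

Lemma idealP S N : ideal S N <->
  [/\ N `<=` S, GRing.zmod_closed [in N],
      forall s x, S s -> N x -> N (s * x) & forall x s, N x -> S s -> N (x * s)].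
Proof.
split=> [[[NS zN Nl] [_ _ Nr]]|[NS zN Nl Nr]]; first by split.
by split; split.
Qed.

Lemma ideal_one S N : subring S -> ideal S N -> N 1 -> N = S.
Proof.
move=> rS /idealP[NS _ Nl _] N1; apply/seteqP; split=> // s Ss.
by rewrite -[s]mulr1; apply: Nl.
Qed.

Lemma left_submodule_sumset S M A B : GRing.zmod_closed [in M] ->
  left_submodule S M A -> left_submodule S M B -> left_submodule S M (sumset A B).
Proof.
move=> zM [AM zA SA] [BM zB SB]; split; [exact: sumset_sub|exact: zmod_sumset|].
move=> s _ Ss [a Aa [b Bb <-]]; rewrite mulrDr; exists (s * a); first exact: SA.
by exists (s * b) => //; apply: SB.
Qed.

Lemma left_submodule_refl S : subring S -> left_submodule S S S.
Proof. by move=> rS; split=> // [|s x]; [exact: subring_zmod|exact: subringM]. Qed.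

Lemma left_submodule_cyclic S M m : subring S -> left_submodule S M M -> M m ->
  left_submodule S M [set s * m | s in S].
Proof.
move=> rS [_ zM SM] Mm; split; first by move=> _ [u Su <-]; apply: SM.
  apply/zmod_closedP; split.
    by exists 0; [exact: zmod0 (subring_zmod rS)|rewrite mul0r].
  move=> _ _ [u Su <-] [v Sv <-]; exists (u - v); last by rewrite mulrBl.
  exact: zmodB (subring_zmod rS) _ _.
by move=> t _ St [u Su <-]; exists (t * u); [exact: subringM|rewrite mulrA].
Qed.

Lemma ideal_sumset S A B : subring S ->
  ideal S A -> ideal S B -> ideal S (sumset A B).
Proof.
move=> rS /idealP[AS zA Al Ar] /idealP[BS zB Bl Br]; apply/idealP.
split; [by apply: sumset_sub => //; apply: subring_zmod|exact: zmod_sumset|..].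
- move=> s _ Ss [a Aa [b Bb <-]]; rewrite mulrDr; exists (s * a); first exact: Al.
  by exists (s * b) => //; apply: Bl.
- move=> _ s [a Aa [b Bb <-]] Ss; rewrite mulrDl; exists (a * s); first exact: Ar.
  by exists (b * s) => //; apply: Br.
Qed.

(* [N0 `|` X] makes the union of the empty chain equal to [N0]. *)
Lemma exists_maximal (F : set (set T)) N0 :
  (forall G : set (set T), G !=set0 -> G `<=` F -> total_on G subset ->
     F (\bigcup_(X in G) X)) ->
  F N0 -> ~ N0 1 ->
  exists N, [/\ F N, N0 `<=` N, ~ N 1 &
    forall K, F K -> N `<=` K -> K = N \/ K 1].
Proof.
move=> chainF FN0 N01.
have [G GP totG|A [[FA A1] maxA]] :=
    @Zorn_bigcup T [set X | F (N0 `|` X) /\ ~ (N0 `|` X) 1].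
  have [[X0 GX0]|/set0P/negP/negPn/eqP->] := pselect (G !=set0); last first.
    by rewrite bigcup_set0; split; rewrite setU0.
  have UE : N0 `|` \bigcup_(X in G) X = \bigcup_(Y in [set N0 `|` X | X in G]) Y.
    rewrite bigcup_image; apply/seteqP; split=> [x [N0x|[X GX Xx]]|x [X GX [N0x|Xx]]].
    - by exists X0 => //; left.
    - by exists X => //; right.
    - by left.
    - by right; exists X.
  split; rewrite UE; last by move=> [_ [X /GP[_ X1] <-]].
  apply: chainF; first by exists (N0 `|` X0), X0.
    by move=> _ [X /GP[FX _] <-].
  move=> _ _ [X GX <-] [Y GY <-].
  by have [XY|YX] := totG _ _ GX GY; [left|right]; apply: setUS.
exists (N0 `|` A); split=> // K FK NK.
have [K1|K1] := pselect (K 1); [by right|left].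
have N0K : N0 `|` K = K by apply: setUidr => x N0x; apply: NK; left.
have [KA|KA] := pselect (K `<=` N0 `|` A); first by apply/seteqP.
exfalso; apply: (maxA K); last by split; rewrite N0K.
split; first by move=> x Ax; apply: NK; right.
by move=> KA'; apply: KA => x /KA'; right.
Qed.

Lemma left_submodule_bigcup S M (G : set (set T)) :
  G !=set0 -> G `<=` left_submodule S M -> total_on G subset ->
  left_submodule S M (\bigcup_(X in G) X).
Proof.
move=> [X0 GX0] GS totG; split.
- by move=> x [X /GS[XM _ _] /XM].
- apply/zmod_closedP; split; first by exists X0 => //; apply: zmod0; case: (GS _ GX0).
  move=> x y [X GX Xx] [Y GY Yy].
  by have [XY|YX] := totG _ _ GX GY; [exists Y|exists X] => //; apply: zmodB;
    by [case: (GS _ GX)|case: (GS _ GY)|apply: XY|apply: YX|].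
- by move=> s x Ss [X GX Xx]; exists X => //; case: (GS _ GX) => _ _; apply.
Qed.

Lemma exists_maximal_left S N0 : subring S -> left_submodule S S N0 -> ~ N0 1 ->
  exists2 N, maximal_left_submodule S S N & N0 `<=` N.
Proof.
move=> rS subN0 N01.
have [N [subN N0N N1 maxN]] :=
  exists_maximal (@left_submodule_bigcup S S) subN0 N01.
exists N => //; split=> // [NS|K subK NK]; first by apply: N1; rewrite NS; apply: subring1.
have [|K1] := maxN K subK NK; [by left|right].
case: subK => KS _ SK; apply/seteqP; split=> // s Ss.
by rewrite -[s]mulr1; apply: SK.
Qed.

Lemma maximal_left1 S N : subring S -> maximal_left_submodule S S N -> ~ N 1.
Proof.
move=> rS [[NS _ SN] neqN _] N1; apply: neqN; apply/seteqP; split=> // s Ss.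
by rewrite -[s]mulr1; apply: SN.
Qed.

(** * Left quasi-regular elements and the Jacobson radical *)

Definition left_quasiregular S x := exists2 u, S u & u * (1 - x) = 1.

(** Jacobson's identity: if [u] is a left inverse of [1 - x * s], then [1 + s * u * x] is one of
    [1 - s * x]. It links left ideals to right ideals below. *)
Lemma left_quasiregularC S s x : subring S -> S s -> S x ->
  left_quasiregular S (x * s) -> left_quasiregular S (s * x).
Proof.
move=> rS Ss Sx [u Su uE]; exists (1 + s * u * x).
  by apply: zmodD (subring_zmod rS) (subring1 rS) _; do ?apply: subringM.
rewrite mulrDl mul1r -!mulrA mulrBr mulr1 mulrA.
have -> : x - x * (s * x) = (1 - x * s) * x by rewrite mulrBl mul1r mulrA.
by rewrite -!mulrA [u * _]mulrA uE mul1r subrK.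
Qed.

Lemma jacobson_sub S : jacobson S `<=` S.
Proof. by move=> x []. Qed.

(** Otherwise the left ideal generated by [1 - s * x] lies in a maximal one, which also contains
    [s * x], hence [1]. *)
Lemma jacobson_quasiregular S x s :
  subring S -> jacobson S x -> S s -> left_quasiregular S (s * x).
Proof.
move=> rS [Sx Jx] Ss.
have S1 : S (1 - s * x).
  by apply: zmodB (subring_zmod rS) (subring1 rS) _; apply: subringM.
pose K := [set u * (1 - s * x) | u in S].
have [[u Su uE]|K1] := pselect (K 1); first by exists u.
have subK : left_submodule S S K := left_submodule_cyclic rS (left_submodule_refl rS) S1.
have [N maxN KN] := exists_maximal_left rS subK K1.
exfalso; apply: (maximal_left1 rS maxN); rewrite -(subrK (s * x) 1).
have [[_ zN SN] _ _] := maxN.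
apply: zmodD => //; last by apply: SN => //; apply: Jx.
by apply: KN; exists 1; [exact: subring1|rewrite mul1r].
Qed.

(** If a maximal left ideal [N] misses [x], then [1 = n + s * x] with [n] in [N], and
    [n = 1 - s * x] has a left inverse, so [N] contains [1]. *)
Lemma quasiregular_jacobson S x : subring S -> S x ->
  (forall s, S s -> left_quasiregular S (s * x)) -> jacobson S x.
Proof.
move=> rS Sx qx; split=> // N maxN; have [subN neqN maxN'] := maxN.
have [NS zN SN] := subN.
apply: contrapT => Nx.
pose K := [set s * x | s in S].
have subK : left_submodule S S K := left_submodule_cyclic rS (left_submodule_refl rS) Sx.
have zK : GRing.zmod_closed [in K] by case: subK.
have [||NKE|NKE] := maxN' (sumset N K).
- exact: left_submodule_sumset (subring_zmod rS) _ _.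
- exact: sub_sumsetl.
- apply: Nx; rewrite -NKE; apply: sub_sumsetr => //.
  by exists 1; [exact: subring1|rewrite mul1r].
- have : sumset N K 1 by rewrite NKE; apply: subring1.
  move=> [n Nn [_ [s Ss <-] nE]].
  have [u Su uE] := qx s Ss.
  apply: (maximal_left1 rS maxN); rewrite -uE -nE addrK; exact: SN.
Qed.

Lemma zmod_left_radical S M : GRing.zmod_closed [in M] ->
  GRing.zmod_closed [in left_radical S M].
Proof.
move=> zM; apply/zmod_closedP; split.
  by split=> [|N [[_ zN _] _ _]]; exact: zmod0.
move=> x y [Mx Jx] [My Jy]; split; first exact: zmodB.
move=> N maxN; have [[_ zN _] _ _] := maxN.
by apply: zmodB => //; [apply: Jx|apply: Jy].
Qed.

Lemma left_radical_submodule S M : left_submodule S M M ->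
  left_submodule S M (left_radical S M).
Proof.
move=> [_ zM SM]; split; [by move=> x []|exact: zmod_left_radical|].
move=> s x Ss [Mx Jx]; split; first exact: SM.
by move=> N maxN; have [[_ _ SN] _ _] := maxN; apply: SN => //; apply: Jx.
Qed.

Lemma ideal_jacobson S : subring S -> ideal S (jacobson S).
Proof.
move=> rS.
have [JS zJ SJ] : left_submodule S S (jacobson S).
  exact: left_radical_submodule (left_submodule_refl rS).
apply/idealP; split=> // x t Jx St.
apply: quasiregular_jacobson => // [|s Ss]; first by apply: subringM => //; apply: JS.
(* [s * x * t] is quasi-regular because [t * s * x] is. *)
rewrite mulrA; apply: left_quasiregularC => //; first by apply: subringM => //; exact: JS.
by rewrite mulrA; apply: jacobson_quasiregular => //; apply: subringM.
Qed.

Lemma jacobson_quasiregular1 S x : subring S -> jacobson S x -> left_quasiregular S x.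
Proof.
move=> rS Jx; rewrite -[x]mul1r.
by apply: jacobson_quasiregular => //; apply: subring1.
Qed.

Lemma left_quasiregular_sub_jacobson S N : subring S -> left_submodule S S N ->
  (forall x, N x -> left_quasiregular S x) -> N `<=` jacobson S.
Proof.
move=> rS [NS _ SN] qN x Nx; apply: quasiregular_jacobson => // [|s Ss]; first exact: NS.
by apply: qN; apply: SN.
Qed.

Lemma right_quasiregular_sub_jacobson S N : subring S -> right_submodule S S N ->
  (forall x, N x -> left_quasiregular S x) -> N `<=` jacobson S.
Proof.
move=> rS [NS _ SN] qN x Nx; apply: quasiregular_jacobson => // [|s Ss]; first exact: NS.
by apply: left_quasiregularC => //; [exact: NS|apply: qN; apply: SN].
Qed.

(** A form of Nakayama's lemma. If [N + S x m] is all of [M], then [(1 - s * x) * m] lies in [N] for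
    some [s], and so does [m]. *)
Lemma jacobson_mul_maximal S M N x m : subring S -> left_submodule S M M ->
  maximal_left_submodule S M N -> jacobson S x -> M m -> N (x * m).
Proof.
move=> rS subM [subN neqN maxN] Jx Mm; have [_ zM SM] := subM.
have [NM zN SN] := subN.
pose K := [set s * (x * m) | s in S].
have Sx := jacobson_sub Jx.
have subK : left_submodule S M K.
  by apply: left_submodule_cyclic => //; apply: SM.
have [_ zK _] := subK.
have [||NKE|NKE] := maxN (sumset N K).
- exact: left_submodule_sumset.
- exact: sub_sumsetl.
- rewrite -NKE; apply: sub_sumsetr => //.
  by exists 1; [exact: subring1|rewrite mul1r].
- have : sumset N K m by rewrite NKE.
  move=> [n Nn [_ [s Ss <-] nE]].
  have [u Su uE] := jacobson_quasiregular rS Jx Ss.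
  apply: (SN) => //; rewrite -[m]mul1r -uE -mulrA; apply: SN => //.
  by rewrite mulrBl mul1r -{1}nE mulrA addrK.
Qed.

(** The submodule [S x m] is zero or everything; in the second case [m = s x m], and invertibility
    of [1 - s * x] forces [m = 0]. *)
Lemma jacobson_act S (M : zmodType) (act : T -> M -> M) x m : subring S ->
  simple_left_module S act -> jacobson S x -> act x m = 0.
Proof.
move=> rS [[act1 actM actDl actDr] _ simM] Jx.
have Sx := jacobson_sub Jx; have zS := subring_zmod rS.
have act0 a : S a -> act a 0 = 0.
  by move=> Sa; apply: (addrI (act a 0)); rewrite -actDr // !addr0.
have act0l n : act 0 n = 0.
  by apply: (addrI (act 0 n)); rewrite -actDl ?addr0 //; exact: zmod0 zS.
have actB a b n : S a -> S b -> act (a - b) n = act a n - act b n.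
  move=> Sa Sb; have Sab : S (a - b) by apply: zmodB.
  by rewrite -[in RHS](subrK b a) (actDl (a - b)) // addrK.
pose K := [set act s (act x m) | s in S].
have [||K0|KT] := simM K.
- apply/zmod_closedP; split; first by exists 0; [exact: zmod0|exact: act0l].
  by move=> _ _ [a Sa <-] [b Sb <-]; exists (a - b); [exact: zmodB|exact: actB].
- by move=> a _ Sa [b Sb <-]; exists (a * b); [exact: subringM|exact: actM].
- have : K (act x m) by exists 1; [exact: subring1|exact: act1].
  by rewrite K0.
- have : K m by rewrite KT.
  move=> [s Ss sE]; have [u Su uE] := jacobson_quasiregular rS Jx Ss.
  suff -> : m = 0 by apply: act0.
  have Ssx : S (s * x) by apply: subringM.
  rewrite -(act1 m) -uE actM ?actB ?act1 ?actM //; [|exact: subring1..|].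
    by rewrite sE subrr act0.
  by apply: zmodB => //; apply: subring1.
Qed.

(** * Maximal two-sided ideals and primeness *)

Lemma ideal_bigcup S (G : set (set T)) :
  G !=set0 -> G `<=` ideal S -> total_on G subset ->
  ideal S (\bigcup_(X in G) X).
Proof.
move=> G0 GI totG.
have GS : G `<=` left_submodule S S by move=> X /GI[].
have [sub z Sl] := left_submodule_bigcup G0 GS totG.
apply/idealP; split=> // x s [X GX Xx] Ss; exists X => //.
by have [_ [_ _ Xr]] := GI _ GX; apply: Xr.
Qed.

Lemma exists_maximal_ideal S N0 : subring S -> ideal S N0 -> ~ N0 1 ->
  exists2 N, maximal_ideal S N & N0 `<=` N.
Proof.
move=> rS idN0 N01.
have [N [idN N0N N1 maxN]] := exists_maximal (@ideal_bigcup S) idN0 N01.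
exists N => //; split=> // [NS|K idK NK]; first by apply: N1; rewrite NS; apply: subring1.
by have [|K1] := maxN K idK NK; [left|right; apply: ideal_one].
Qed.

(** If neither factor lies in [N], then [1 = (n + x) * (m + y)] with [n], [m] in [N], and every term
    of the expansion lies in [N]. *)
Lemma maximal_ideal_prime S N : subring S -> maximal_ideal S N -> prime_ideal S N.
Proof.
move=> rS [idN neqN maxN]; split=> // X Y idX idY XYN.
have [NS zN Nl Nr] := (iffLR (idealP S N)) idN.
have [XS zX _ _] := (iffLR (idealP S X)) idX.
have [YS zY _ _] := (iffLR (idealP S Y)) idY.
have big Z : ideal S Z -> ~ Z `<=` N -> sumset N Z 1.
  move=> idZ ZN; have [_ zZ _ _] := (iffLR (idealP S Z)) idZ.
  have [||E|->] := maxN (sumset N Z); [exact: ideal_sumset|exact: sub_sumsetl|..].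
    by case: ZN; rewrite -E; apply: sub_sumsetr.
  exact: subring1.
have [|/(big _ idX)[n Nn [x Xx E1]]] := pselect (X `<=` N); first by left.
have [|/(big _ idY)[m Nm [y Yy E2]]] := pselect (Y `<=` N); first by right.
exfalso; apply: neqN; apply: ideal_one => //.
rewrite -[1]mulr1 -{1}E1 -E2 mulrDl; apply: zmodD => //.
  by apply: Nr => //; apply: zmodD (subring_zmod rS) _ _; [exact: NS|exact: YS].
rewrite mulrDr; apply: zmodD => //; first by apply: Nl => //; exact: XS.
by apply: XYN; apply: mem_mulset.
Qed.

End Generalities.
(** * Simple quotient modules *)

Section QuotientModule.
Set Implicit Arguments.
Unset Strict Implicit.
Variable T : pzRingType.
Implicit Types N : set T.
Local Open Scope quotient_scope.

(** The module is [T / N], built as a quotient of additive groups. *)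
Lemma quotient_simple_module N : maximal_left_submodule [set: T] [set: T] N ->
  exists (M : zmodType) (act : T -> M -> M), simple_left_module [set: T] act /\
    forall x, (forall m, act x m = 0) <-> forall t, N (x * t).
Proof.
move=> [[_ zN SN] neqN maxN].
pose Z : zmodClosed T := HB.pack (fun x : T => x \in N)
  (GRing.isZmodClosed.Build T (fun x : T => x \in N) zN).
pose Q : zmodType := Quotient.quot Z.
pose p : T -> Q := \pi_(Quotient.quot Z).
have pK (m : Q) : p (repr m) = m by exact: reprK.
have pD x y : p (x + y) = p x + p y by exact: (raddfD \pi_(Quotient.quot Z)).
have pB x y : p (x - y) = p x - p y by exact: (raddfB \pi_(Quotient.quot Z)).
have p0 x : p x = 0 <-> N x.
  have -> : (0 : Q) = p 0 by rewrite -(subrr (p 0)) -pB subrr.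
  split=> [/eqP|Nx]; first by rewrite /p -Quotient.idealrBE subr0 => /set_mem.
  by apply/eqP; rewrite /p -Quotient.idealrBE subr0; apply: mem_set.
(* The action goes through chosen representatives; [actE] shows independence of the choice, [N]
   being a left ideal. *)
pose act (t : T) (q : Q) : Q := p (t * repr q).
have actE t x : act t (p x) = p (t * x).
  apply/eqP; rewrite -subr_eq0 -pB -mulrBr; apply/eqP/p0; apply: SN => //.
  by apply/p0; rewrite pB pK subrr.
have N1 : ~ N 1.
  by move=> N1; apply: neqN; apply/seteqP; split=> // t _; rewrite -[t]mulr1; apply: SN.
exists Q, act; split; last first.
  move=> x; split=> [x0 t|Nx m]; first by apply/p0; rewrite -actE.
  by rewrite -[m]pK actE; apply/p0.
split.
- split=> [m|a b m _ _|a b m _ _|a m m' _].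
  + by rewrite -[m]pK actE mul1r.
  + by rewrite -[m]pK !actE mulrA.
  + by rewrite -[m]pK !actE mulrDl pD.
  + by rewrite -[m]pK -[m']pK -pD !actE mulrDr pD.
- move=> QE; apply: N1; apply/p0.
  by have : [set: Q] (p 1) by []; rewrite QE.
move=> K zK actK.
(* The preimage of a submodule of the quotient is a left ideal containing [N]. *)
pose L := [set x : T | K (p x)].
have [||LE|LE] := maxN L.
- split=> //.
    apply/zmod_closedP; split; first by rewrite /L /= (iffRL (p0 0) (zmod0 zN)); apply: zmod0.
    by move=> x y Lx Ly; rewrite /L /= pB; apply: zmodB.
  by move=> s x _ Lx; rewrite /L /= -actE; apply: actK.
- by move=> x /p0; rewrite /L /= => ->; apply: zmod0.
- left; apply/seteqP; split=> [m Km|_ ->]; last exact: zmod0.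
  by rewrite -[m]pK; apply/p0; rewrite -LE /L /= pK.
- right; apply/seteqP; split=> // m _.
  have Lm : L (repr m) by rewrite LE.
  by rewrite -[m]pK.
Qed.

End QuotientModule.

(** * The converse ring *)

Section Converse.
Set Implicit Arguments.
Unset Strict Implicit.
Variable T : pzRingType.
Implicit Types A B M N S : set T.

(** Stated as an equality of predicates, so that it rewrites inside the notions built from it. *)
Lemma subring_converse : @subring T^c = @subring T.
Proof.
by apply/funext=> S; apply/propext; split=> -[S1 SB SM]; split=> // x y Sx Sy; apply: SM.
Qed.

Lemma maximal_subring_converse : @maximal_subring T^c = @maximal_subring T.
Proof. by rewrite /maximal_subring subring_converse. Qed.

Lemma left_submodule_converse : @left_submodule T^c = @right_submodule T.
Proof.
apply/funext=> S; apply/funext=> M; apply/funext=> N.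
by apply/propext; split=> -[NM zN SN]; split=> // x y Sx Sy; apply: SN.
Qed.

Lemma right_submodule_converse : @right_submodule T^c = @left_submodule T.
Proof.
apply/funext=> S; apply/funext=> M; apply/funext=> N.
by apply/propext; split=> -[NM zN SN]; split=> // x y Sx Sy; apply: SN.
Qed.

Lemma ideal_converse : @ideal T^c = @ideal T.
Proof.
apply/funext=> S; apply/funext=> N.
by rewrite /ideal left_submodule_converse right_submodule_converse; apply/propext; split=> -[].
Qed.

Lemma maximal_left_submodule_converse :
  @maximal_left_submodule T^c = @maximal_right_submodule T.
Proof. by rewrite /maximal_left_submodule left_submodule_converse. Qed.

Lemma left_radical_converse : @left_radical T^c = @right_radical T.
Proof. by rewrite /left_radical maximal_left_submodule_converse. Qed.

Lemma left_module_converse S (M : zmodType) (act : T -> M -> M) :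
  @is_left_module T^c S M act <-> @is_right_module T S M (fun m t => act t m).
Proof.
split=> -[act1 actM actDl actDr]; split=> //.
- by move=> m a b Sa Sb; rewrite actM.
- by move=> m a b; apply: actDl.
- by move=> m m' a; apply: actDr.
- by move=> a b m Sa Sb; rewrite actM.
- by move=> a b m; apply: actDl.
- by move=> a m m'; apply: actDr.
Qed.

Lemma left_primitive_ideal_converse :
  @left_primitive_ideal T^c = @right_primitive_ideal T.
Proof.
apply/funext=> S; apply/funext=> P; apply/propext; split=> -[M [act [[mod nz simM] PE]]].
  exists M, (fun m t => act t m); split=> //; split=> //.
    by apply/left_module_converse.
  by move=> N zN SN; apply: simM => // a m Sa Nm; apply: SN.
exists M, (fun t m => act m t); split=> //; split=> //.
  exact/left_module_converse.
by move=> N zN SN; apply: simM => // a m Sa Nm; apply: SN.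
Qed.

End Converse.

(** Left inverses are two-sided here: if [u * (1 - x * s) = 1], then [u = 1 + u * (x * s)] is again
    [1] minus an element of the radical, so it has a left inverse, which must be [1 - x * s]. *)
Lemma jacobson_converse_sub (T : pzRingType) (S : set T) :
  subring S -> jacobson S `<=` @jacobson T^c S.
Proof.
move=> rS x Jx; have Sx := jacobson_sub Jx.
apply: (@quasiregular_jacobson T^c) => // [|s Ss]; first by rewrite subring_converse.
have [_ _ _ Jr] := (iffLR (idealP S _)) (ideal_jacobson rS).
have Jxs : jacobson S (x * s) by apply: Jr.
have [u Su uE] := jacobson_quasiregular1 rS Jxs.
exists u => //.
have uE1 : u = 1 - - u * (x * s).
  by rewrite mulNr opprK; apply/eqP; rewrite -subr_eq -uE mulrBr mulr1.
have SNu : S (- u) by apply: zmodN => //; apply: subring_zmod.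
have [v Sv vE] := jacobson_quasiregular rS Jxs SNu.
suff vE' : v = 1 - x * s by rewrite -uE1 vE' in vE.
by rewrite -[v]mulr1 -[in LHS]uE mulrA [v * u](_ : _ = 1) ?mul1r // uE1.
Qed.

Lemma jacobson_converse (T : pzRingType) (S : set T) :
  subring S -> @jacobson T^c S = jacobson S.
Proof.
move=> rS; apply/seteqP; split; last first.
  exact (@jacobson_converse_sub T S rS).
have rSc : @subring T^c S by rewrite subring_converse.
exact (@jacobson_converse_sub T^c S rSc).
Qed.

(** * Krull dimension *)

(** Ensures that [supremum] in [krull_dim] is a genuine supremum: [+oo] for an unbounded set, [-oo]
    for the empty one, the maximum otherwise. *)
Lemma supremums_nat_ereal (A : set nat) :
  supremums [set (n%:Z)%:E | n in A] !=set0.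
Proof.
have [[N AN]|unbA] := pselect (exists N, forall n, A n -> (n <= N)%N); last first.
  exists +oo%E; split=> [x _|y ubA]; first exact: leey.
  suff -> : y = +oo%E by [].
  have ubA' n : A n -> ((n%:Z)%:E <= y)%E by move=> An; apply: ubA; exists n.
  case: y ubA' {ubA} => [z|//|] ubA; exfalso; apply: unbA.
    exists `|z|%N => n /ubA; rewrite lee_fin => nz.
    by rewrite -lez_nat (le_trans nz) // lez_abs.
  by exists 0%N => n /ubA.
have [[n0 An0]|A0] := pselect (A !=set0); last first.
  exists -oo%E; split=> [x [n An _]|y _]; last exact: leNye.
  by exfalso; apply: A0; exists n.
have exA : exists n, `[< A n >] by exists n0; apply/asboolP.
have ubA n : `[< A n >] -> (n <= N)%N by move/asboolP/AN.
case: (ex_maxnP exA ubA) => m /asboolP Am maxm.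
exists (m%:Z)%:E; split=> [_ [n An <-]|y]; last by apply; exists m.
by rewrite lee_fin lez_nat; apply: maxm; apply/asboolP.
Qed.

Lemma prime_chain_krull_dim (T : pzRingType) (S : set T) n (P : nat -> set T) :
  prime_chain S n P -> ((n%:Z)%:E <= krull_dim S)%E.
Proof.
move=> chP; apply: ge_supremum_Nmem; first exact: supremums_nat_ereal.
by exists n => //; exists P.
Qed.

(** * Ideal complements of maximal subrings *)

Section Complement.
Set Implicit Arguments.
Unset Strict Implicit.
Variables (T : pzRingType) (R I : set T).
Hypotheses (maxR : maximal_subring R) (idI : ideal [set: T] I)
  (defT : direct_sum R I [set: T]).
Implicit Types K N P S X Y : set T.
Local Notation J := (jacobson R).
Local Notation L := (left_ann I).

Lemma maximal_subring_subring : subring R. Proof. by case: maxR. Qed.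
Let rR := maximal_subring_subring.
Let zR := subring_zmod rR.
Let rT := subringT T.

Let zI : GRing.zmod_closed [in I]. Proof. by case: idI => -[]. Qed.
Let Il t i : I i -> I (t * i). Proof. by move=> Ii; case: idI => -[_ _ +] _; apply. Qed.
Let Ir t i : I i -> I (i * t). Proof. by move=> Ii; case: idI => _ [_ _ +]; apply. Qed.

Lemma complement_eq0 x : R x -> I x -> x = 0.
Proof. by move=> Rx Ix; have : (R `&` I) x by []; case: defT => _ ->. Qed.

Lemma complement_decomp t : exists r i, [/\ R r, I i & t = r + i].
Proof. by apply/sumsetP; case: defT => ->. Qed.

Lemma complement_neq0 : I <> [set 0].
Proof.
move=> I0; have [_ neqR _] := maxR; apply: neqR; apply/seteqP; split=> // t _.
by have [r [i [Rr Ii ->]]] := complement_decomp t; move: Ii; rewrite I0 => ->; rewrite addr0.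
Qed.

Lemma complement_not_sub : ~ I `<=` R.
Proof.
move=> IR; apply: complement_neq0; apply/seteqP; split=> [i Ii|_ ->]; last exact: zmod0.
by apply: complement_eq0 => //; apply: IR.
Qed.

(** [R + K] is a subring containing [R], so it is [R] or [T]; directness of the sum turns this into
    [K = 0] or [K = I]. *)
Lemma complement_bimodule K : GRing.zmod_closed [in K] -> K `<=` I ->
  (forall r x, R r -> K x -> K (r * x)) -> (forall r x, R r -> K x -> K (x * r)) ->
  (forall x y, K x -> K y -> K (x * y)) -> K = [set 0] \/ K = I.
Proof.
move=> zK KI Kl Kr KM.
have [_ _ maxR'] := maxR.
have [||E|E] := maxR' (sumset R K).
- apply: subringP; [|exact: zmod_sumset|].
    by apply: sub_sumsetl => //; apply: subring1.
  move=> _ _ [r Rr [k Kk <-]] [r' Rr' [k' Kk' <-]].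
  rewrite mulrDl !mulrDr -addrA; exists (r * r'); first exact: subringM.
  by exists (r * k' + (k * r' + k * k')) => //; do 2?apply: zmodD => //;
     [apply: Kl|apply: Kr|apply: KM].
- exact: sub_sumsetl.
- left; apply/seteqP; split=> [k Kk|_ ->]; last exact: zmod0.
  by apply: complement_eq0; [rewrite -E; apply: sub_sumsetr|apply: KI].
- right; apply/seteqP; split=> // i Ii.
  have : sumset R K i by rewrite E.
  move=> [r Rr [k Kk kE]].
  suff -> : i = k by [].
  apply/eqP; rewrite -subr_eq0; apply/eqP; apply: complement_eq0.
    by rewrite -kE addrK.
  by apply: zmodB => //; apply: KI.
Qed.

(** Minimality of [I], applied to the intersection of [N] and [I]. *)
Lemma ideal_dichotomy N : ideal [set: T] N ->
  (forall x, N x -> I x -> x = 0) \/ I `<=` N.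
Proof.
move=> /idealP[_ zN Nl Nr].
have [|||||E|E] := @complement_bimodule (N `&` I).
- exact: zmod_closedI.
- by move=> x [].
- by move=> r x _ [Nx Ix]; split; [apply: Nl|apply: Il].
- by move=> r x _ [Nx Ix]; split; [apply: Nr|apply: Ir].
- by move=> x y [Nx Ix] [Ny Iy]; split; [apply: Nl|apply: Il].
- by left=> x Nx Ix; have : (N `&` I) x by []; rewrite E.
- by right; rewrite -E => x [].
Qed.

(** The component [r] of [u] in [R] is already a left inverse: [r * (1 - x) - 1] lies in both [R]
    and [I]. *)
Lemma complement_left_inverse u x : R x -> u * (1 - x) = 1 -> left_quasiregular R x.
Proof.
move=> Rx uE; have [r [i [Rr Ii rE]]] := complement_decomp u.
have Rx1 : R (1 - x) by apply: zmodB => //; apply: subring1.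
exists r => //; apply/eqP; rewrite -subr_eq0; apply/eqP; apply: complement_eq0.
  by apply: zmodB; [|apply: subringM|apply: subring1].
by rewrite -[X in _ - X]uE rE mulrDl opprD addrA subrr sub0r; apply: zmodN => //; apply: Ir.
Qed.

Lemma jacobsonT_sub : jacobson [set: T] `&` R `<=` J.
Proof.
move=> x [Jx Rx]; apply: quasiregular_jacobson => // s Rs.
have [u _ uE] := jacobson_quasiregular rT Jx (Logic.I : setT s).
by apply: complement_left_inverse uE; apply: subringM.
Qed.

(** For [t = r + i] and [u] a left inverse of [1 - r * a], one gets
    [u * (1 - t * a) = 1 - u * i * a], where [u * i * a] lies in [I], hence in the radical of
    [T]. *)
Lemma jacobson_sub_jacobsonT : I `<=` jacobson [set: T] -> J `<=` jacobson [set: T].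
Proof.
move=> IJT a Ja; apply: quasiregular_jacobson => // t _.
have [r [i [Rr Ii ->]]] := complement_decomp t.
have [u Ru uE] := jacobson_quasiregular rR Ja Rr.
have JTi : jacobson [set: T] (u * i * a) by apply: IJT; apply: Ir; apply: Il.
have [v _ vE] := jacobson_quasiregular1 rT JTi.
by exists (v * u) => //; rewrite mulrDl opprD addrA -mulrA [u * _]mulrBr uE !mulrA.
Qed.

(** Since [T / I] is isomorphic to [R], primes of [R] correspond to primes of [T] containing [I];
    the argument avoids forming the quotient. *)
Lemma prime_ideal_lift P : prime_ideal R P -> prime_ideal [set: T] (sumset P I).
Proof.
move=> [idP neqP primeP]; have [PR zP Pl Pr] := (iffLR (idealP R P)) idP.
(* [low X] is the image of [X] under the projection of [T] onto [R] along [I]. *)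
pose low X := R `&` sumset X I.
have sub_low X : GRing.zmod_closed [in X] -> X `<=` sumset (low X) I.
  move=> zX x Xx; have [r [i [Rr Ii xE]]] := complement_decomp x.
  exists r; last by exists i.
  split=> //; exists x => //; exists (- i); first exact: zmodN.
  by rewrite xE addrK.
have id_low X : ideal [set: T] X -> ideal R (low X).
  move=> idX; have /idealP[_ zXI XIl XIr] := ideal_sumset rT idX idI.
  apply/idealP; split; [by move=> x []|exact: zmod_closedI|..].
    by move=> s x Rs [Rx Xx]; split; [exact: subringM|exact: XIl].
  by move=> x s [Rx Xx] Rs; split; [exact: subringM|exact: XIr].
have lowP X : X `<=` sumset P I -> low X `<=` P.
  move=> XP x [Rx [y /XP[p Pp [i Ii <-]] [i' Ii' xE]]].
  suff -> : x = p by [].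
  apply/eqP; rewrite -subr_eq0; apply/eqP; apply: complement_eq0.
    by apply: zmodB => //; apply: PR.
  by rewrite -xE -(addrA p) [_ - p]addrC addKr; apply: zmodD.
split.
- apply/idealP; split=> //; first exact: zmod_sumset.
    move=> t _ _ [p Pp [i Ii <-]]; have [r [j [Rr Ij ->]]] := complement_decomp t.
    rewrite mulrDl mulrDr -addrA; exists (r * p); first exact: Pl.
    by exists (r * i + j * (p + i)) => //; apply: zmodD => //; [apply: Il|apply: Ir].
  move=> _ t [p Pp [i Ii <-]] _; have [r [j [Rr Ij ->]]] := complement_decomp t.
  rewrite mulrDr mulrDl -addrA; exists (p * r); first exact: Pr.
  by exists (i * r + (p + i) * j) => //; apply: zmodD => //; [apply: Ir|apply: Il].
- move=> PT; apply: neqP; apply: ideal_one => //.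
  by apply: (lowP setT) => //; [rewrite PT|split; [exact: subring1|exact: sub_sumsetl]].
- move=> X Y idX idY XY.
  have /idealP[_ zX Xl Xr] := idX; have /idealP[_ zY Yl Yr] := idY.
  have [|low_sub|low_sub] := primeP _ _ (id_low X idX) (id_low Y idY).
  + apply: mulset_sub => // x' y' [Rx [x Xx [i Ii xE]]] [Ry [y Yy [j Ij yE]]].
    apply: (lowP _ XY); split; first exact: subringM.
    rewrite -xE -yE mulrDl mulrDr -addrA; exists (x * y); first exact: mem_mulset.
    by exists (x * j + i * (y + j)) => //; apply: zmodD => //; [apply: Il|apply: Ir].
  + by left=> x /(sub_low _ zX)[y /low_sub Py [i Ii <-]]; exists y => //; exists i.
  + by right=> x /(sub_low _ zY)[y /low_sub Py [i Ii <-]]; exists y => //; exists i.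
Qed.

(** * The case where the radical of [R] is not contained in that of [T] *)

Section NonRadical.
Hypothesis nJ : ~ J `<=` jacobson [set: T].

Lemma complement_jacobsonT_eq0 x : jacobson [set: T] x -> I x -> x = 0.
Proof.
have [|/jacobson_sub_jacobsonT//] := ideal_dichotomy (ideal_jacobson rT).
by apply.
Qed.

Lemma complement_not_sub_jacobsonT : ~ I `<=` jacobson [set: T].
Proof. by move=> /jacobson_sub_jacobsonT. Qed.

(** Otherwise [I I = 0]; then [1 + x] inverts [1 - x] for [x] in [I], and [I] lies in the radical of
    [T]. *)
Lemma complement_idempotent : mulset I I = I.
Proof.
have MI : mulset I I `<=` I by apply: mulset_sub => // a b _; apply: Il.
have [|||||E|//] := @complement_bimodule (mulset I I).
- exact: zmod_mulset.
- exact: MI.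
- by move=> r x _; apply: mulset_mull => a; apply: Il.
- by move=> r x _; apply: mulset_mulr => a; apply: Ir.
- by move=> x y _ Ky; apply: mulset_mull Ky => a; apply: Il.
case: complement_not_sub_jacobsonT; apply: left_quasiregular_sub_jacobson => //.
  by case: idI.
move=> x Ix; have xx : x * x = 0.
  by have : mulset I I (x * x) by [exact: mem_mulset]; rewrite E.
by exists (1 + x) => //; rewrite mulrBr mulr1 mulrDl mul1r xx addr0 addrK.
Qed.

Lemma complement_not_square_zero : ~ (forall x y, I x -> I y -> x * y = 0).
Proof.
move=> I0; apply: complement_neq0; rewrite -complement_idempotent.
apply/seteqP; split; last by move=> _ ->; apply: zmod0; apply: zmod_mulset.
by apply: mulset_sub; [exact: zmod_closed0|exact: I0].
Qed.

(** * Products of the radical of [R] with [I] and with [T] *)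

Let Jid := (iffLR (idealP R J)) (ideal_jacobson rR).

(** If [J I = 0], then [j * (r + i) = j * r] makes [J] a right ideal of [T] with quasi-regular
    elements, so [J] lies in the radical of [T]. *)
Lemma jacobson_mul_complement : mulset J I = I.
Proof.
have [JR zJ Jl Jr] := Jid.
have [|||||E|//] := @complement_bimodule (mulset J I).
- exact: zmod_mulset.
- by apply: mulset_sub => // a b _; apply: Il.
- by move=> r x Rr; apply: mulset_mull => a; apply: Jl.
- by move=> r x _; apply: mulset_mulr => a; apply: Ir.
- move=> x y [n [a [b [Ja Ib ->]]]] Ky.
  rewrite mulr_suml; apply: zmod_sum; first exact: zmod_mulset.
  move=> i; rewrite -mulrA; apply: mem_mulset => //.
  by apply: Ir; apply: Ib.
case: nJ; apply: right_quasiregular_sub_jacobson => //; last first.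
  by move=> x Jx; have [u _ uE] := jacobson_quasiregular1 rR Jx; exists u.
split=> // j t Jj _; have [r [i [Rr Ii ->]]] := complement_decomp t.
have -> : j * (r + i) = j * r; last exact: Jr.
have : mulset J I (j * i) by apply: mem_mulset.
by rewrite E => ji; rewrite mulrDr ji addr0.
Qed.

(** Mirror image: [I J = 0] would make [J] a quasi-regular left ideal of [T]. *)
Lemma complement_mul_jacobson : mulset I J = I.
Proof.
have [JR zJ Jl Jr] := Jid.
have [|||||E|//] := @complement_bimodule (mulset I J).
- exact: zmod_mulset.
- by apply: mulset_sub => // a b Ia _; apply: Ir.
- by move=> r x _; apply: mulset_mull => a; apply: Il.
- by move=> r x Rr; apply: mulset_mulr => a Ja; apply: Jr.
- move=> x y _; apply: mulset_mull => a; exact: Il.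
case: nJ; apply: left_quasiregular_sub_jacobson => //; last first.
  by move=> x Jx; have [u _ uE] := jacobson_quasiregular1 rR Jx; exists u.
split=> // t j _ Jj; have [r [i [Rr Ii ->]]] := complement_decomp t.
have -> : (r + i) * j = r * j; last exact: Jl.
have : mulset I J (i * j) by apply: mem_mulset.
by rewrite E => ij; rewrite mulrDl ij addr0.
Qed.

(** [T J = R J + I J], with [R J = J] and [I J = I]. The same value is found for [J T], whence the
    two agree. *)
Lemma mulTJ : mulset [set: T] J = sumset J I.
Proof.
have [JR zJ Jl Jr] := Jid.
apply/seteqP; split.
  apply: mulset_sub; first exact: zmod_sumset.
  move=> t j _ Jj; have [r [i [Rr Ii ->]]] := complement_decomp t.
  by rewrite mulrDl; exists (r * j); [exact: Jl|exists (i * j) => //; apply: Ir].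
apply: sumset_sub; first by apply: zmod_mulset; apply: zmod_closedT.
  by move=> j Jj; rewrite -[j]mul1r; apply: mem_mulset.
rewrite -{1}complement_mul_jacobson; apply: mulset_sub.
  by apply: zmod_mulset; apply: zmod_closedT.
by move=> i j _; apply: mem_mulset.
Qed.

Lemma mulJT : mulset J [set: T] = sumset J I.
Proof.
have [JR zJ Jl Jr] := Jid.
apply/seteqP; split.
  apply: mulset_sub; first exact: zmod_sumset.
  move=> j t Jj _; have [r [i [Rr Ii ->]]] := complement_decomp t.
  by rewrite mulrDr; exists (j * r); [exact: Jr|exists (j * i) => //; apply: Il].
apply: sumset_sub; first exact: zmod_mulset.
  by move=> j Jj; rewrite -[j]mulr1; apply: mem_mulset.
rewrite -{1}jacobson_mul_complement; apply: mulset_sub; first exact: zmod_mulset.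
by move=> j i Jj _; apply: mem_mulset.
Qed.

(** * The left annihilator of [I]: conductor, primeness, primitivity *)

Lemma ideal_left_ann : ideal [set: T] L.
Proof.
apply/idealP; split=> //.
- apply/zmod_closedP; split=> [i _|x y Lx Ly i Ii]; first by rewrite mul0r.
  by rewrite mulrBl Lx // Ly // subrr.
- by move=> s x _ Lx i Ii; rewrite -mulrA Lx // mulr0.
- by move=> x s Lx _ i Ii; rewrite -mulrA Lx //; apply: Il.
Qed.

(* If [T = R + L] then [I = J I <= J + L], and elements of [J + L] that lie in
   [I] are quasi-regular because [L I = 0]. *)
Lemma left_ann_sub : L `<=` R.
Proof.
have /idealP[_ zL Ll Lr] := ideal_left_ann.
have [_ _ maxR'] := maxR.
have [||<-|E] := maxR' (sumset R L).
- apply: subringP; [|exact: zmod_sumset|].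
    by apply: sub_sumsetl => //; apply: subring1.
  move=> _ _ [r Rr [l Ll' <-]] [s Rs [k Lk <-]].
  rewrite mulrDl mulrDr -addrA; exists (r * s); first exact: subringM.
  by exists (r * k + l * (s + k)) => //; apply: (zmodD zL); [exact: Ll|exact: Lr].
- exact: sub_sumsetl.
- exact: sub_sumsetr.
case: complement_not_sub_jacobsonT; apply: left_quasiregular_sub_jacobson => //.
  by case: idI.
move=> x Ix.
have [JR zJ Jl Jr] := Jid.
have [j Jj [l Ll' xE]] : sumset J L x.
  suff sub : mulset J I `<=` sumset J L by apply: sub; rewrite jacobson_mul_complement.
  apply: mulset_sub; first exact: (zmod_sumset zJ zL).
  move=> j y Jj _; have : sumset R L y by rewrite E.
  move=> [r Rr [l Ll' <-]]; rewrite mulrDr.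
  by exists (j * r); [exact: Jr|exists (j * l) => //; apply: Ll].
have [u Ru uE] := jacobson_quasiregular1 rR Jj.
(* With [x = j + l]: [u * (1 - x) = 1 - u * l], while [u * l * (1 - x) = u * l] because [l] kills
   [x]. *)
exists (u + u * l) => //.
have ulx : u * l * x = 0 by rewrite -mulrA Ll' // mulr0.
rewrite mulrDl [u * l * _]mulrBr mulr1 ulx subr0.
by rewrite -xE opprD addrA mulrBr uE subrK.
Qed.

(** If [x] is in the conductor and [i] in [I], then [x * i] lies in both [R] and [I]. Conversely [L]
    is an ideal of [T] inside [R]. *)
Lemma conductor_left_ann : conductor R = L.
Proof.
have /idealP[_ _ Ll Lr] := ideal_left_ann.
apply/seteqP; split=> [x Cx i Ii|x Lx t u].
  by apply: complement_eq0; [rewrite -[x]mul1r; apply: Cx|apply: Il].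
by apply: left_ann_sub; apply: Lr => //; apply: Ll.
Qed.

Lemma right_conductor_left_ann : right_conductor R = L.
Proof.
have /idealP[_ _ Ll Lr] := ideal_left_ann.
apply/seteqP; split=> [x Cx i Ii|x Lx t].
  by apply: complement_eq0; [apply: Cx|apply: Il].
by apply: left_ann_sub; apply: Lr.
Qed.

Lemma jacobsonT_sub_left_ann : jacobson [set: T] `<=` L.
Proof.
move=> x JTx i Ii; apply: complement_jacobsonT_eq0; last exact: Il.
have /idealP[_ _ _ JTr] := ideal_jacobson rT.
exact: JTr.
Qed.

Lemma left_ann_not1 : ~ L 1.
Proof.
move=> L1; apply: complement_neq0; apply/seteqP; split=> [i Ii|_ ->]; last exact: zmod0.
by rewrite /= -[i]mul1r L1.
Qed.

(** Let [X Y] lie in [L]. By minimality [Y I] is [0] or [I]: either [Y] kills [I], or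
    [X I = X Y I = 0]. The ring [S] will be both [R] and [T]. *)
Lemma prime_left_ann S : subring S -> R `<=` S -> prime_ideal S L.
Proof.
move=> rS RS; have /idealP[_ zL Ll Lr] := ideal_left_ann.
split.
- by apply/idealP; split=> // [x Lx|s x _|x s Lx _];
    [apply/RS/left_ann_sub|apply: Ll|apply: Lr].
- by move=> LS; apply: left_ann_not1; rewrite LS; apply: subring1.
move=> X Y /idealP[XS zX _ _] /idealP[YS zY Yl Yr] XY.
have [|||||E|E] := @complement_bimodule (mulset Y I).
- exact: zmod_mulset.
- by apply: mulset_sub => // y i _; apply: Il.
- by move=> r x Rr; apply: mulset_mull => y; apply: Yl; apply: RS.
- by move=> r x _; apply: mulset_mulr => y; apply: Ir.
- move=> x y [n [a [b [Ya Ib ->]]]] _.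
  rewrite mulr_suml; apply: zmod_sum; first exact: zmod_mulset.
  by move=> i; rewrite -mulrA; apply: mem_mulset => //; apply: Ir.
- right=> y Yy i Ii; have : mulset Y I (y * i) by apply: mem_mulset.
  by rewrite E.
left=> x Xx i; rewrite -E; move: i.
suff sub0 : mulset Y I `<=` [set z | x * z = 0] by [].
apply: mulset_sub.
  by apply/zmod_closedP; split=> [|y z /= xy xz]; rewrite /= ?mulr0 // mulrBr xy xz subrr.
by move=> y i Yy Ii; rewrite /= mulrA; apply: XY => //; apply: mem_mulset.
Qed.

(** As [L I = 0], a prime [Q] inside [L] contains [L] or [I]; in the second case [I] would kill
    itself. *)
Lemma minimal_prime_left_ann : minimal_prime_ideal [set: T] L.
Proof.
split=> [|Q [/idealP[_ zQ _ _] _ primeQ] QL]; first exact: prime_left_ann.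
apply/seteqP; split=> //.
have LIQ : mulset L I `<=` Q.
  by apply: mulset_sub => // x i Lx Ii; rewrite Lx //; apply: zmod0.
have [//|IQ] := primeQ L I ideal_left_ann idI LIQ.
by case: complement_not_square_zero => x y /IQ/QL Lx; apply: Lx.
Qed.

(** [L] itself is not maximal in [R]: otherwise [J + L] is [L], and [J I = 0], or it is [R], and
    then [1 = j + l] makes [l = 1 - j] left invertible, so [1] is in [L]. *)
Lemma exists_maximal_ideal_left_ann :
  exists M, [/\ maximal_ideal R M, prime_ideal R M & L `<` M].
Proof.
have [idL neqL _] := prime_left_ann rR (@subset_refl _ R).
have [M maxM LM] := exists_maximal_ideal rR idL left_ann_not1.
exists M; split=> //; first exact: maximal_ideal_prime.
split=> // ML; have LE : L = M by apply/seteqP.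
have [JR zJ _ _] := Jid; have [_ zL Ll _] := (iffLR (idealP R L)) idL.
have [_ _ maxL] := maxM; rewrite -LE in maxL.
have [||E|E] := maxL (sumset J L).
- by apply: ideal_sumset => //; apply: ideal_jacobson.
- exact: sub_sumsetr.
- apply: complement_neq0; rewrite -jacobson_mul_complement.
  apply/seteqP; split=> [|_ ->]; last by apply: zmod0; apply: zmod_mulset.
  apply: mulset_sub; first exact: zmod_closed0.
  move=> j i Jj Ii; have Lj : L j by rewrite -E; apply: sub_sumsetl.
  exact: Lj.
- have : sumset J L 1 by rewrite E; apply: subring1.
  move=> [j Jj [l Ll' jE]]; have [u Ru uE] := jacobson_quasiregular1 rR Jj.
  apply: left_ann_not1; rewrite -uE -jE addrC addKr; exact: Ll.
Qed.

(** Some maximal left ideal [N] of [T] does not contain [I], as [I] is not in the radical; [L] is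
    the annihilator of [T / N]. *)
Lemma left_primitive_left_ann : left_primitive_ideal [set: T] L.
Proof.
have [N maxN IN] : exists2 N, maximal_left_submodule [set: T] [set: T] N & ~ I `<=` N.
  apply: contrapT => noN; apply: complement_not_sub_jacobsonT => i Ii; split=> // N maxN.
  by apply: contrapT => Ni; apply: noN; exists N => // /(_ i Ii).
have [M [act [simM annM]]] := quotient_simple_module maxN.
exists M, act; split=> //.
have [[_ zN Nl] _ maxN'] := maxN.
have NTP x : (forall t, N (x * t)) <-> L x.
  have idP : ideal [set: T] [set x | forall t, N (x * t)].
    apply/idealP; split=> // [|s y _ Ny t|y s Ny _ t].
    - apply/zmod_closedP; split=> [t|y z Ny Nz t]; first by rewrite mul0r; apply: zmod0.
      by rewrite mulrBl; apply: zmodB.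
    - by rewrite -mulrA; apply: Nl.
    - by rewrite -mulrA; apply: Ny.
  (* The annihilator of [T / N] cannot contain [I], for it lies in [N]; hence it meets [I] in
     [0]. *)
  have [P0|IP] := ideal_dichotomy idP; last first.
    by case: IN => i /IP /(_ 1); rewrite mulr1.
  have /idealP[_ _ Pl Pr] := idP.
  split=> [Nx i Ii|Lx t]; first by apply: P0; [exact: Pr|exact: Il].
  (* By maximality [N + I = T], so [t = n + i] and [x * t = x * n] lies in [N]. *)
  have [||E|E] := maxN' (sumset N I).
  - by apply: left_submodule_sumset; [exact: zmod_closedT|case: maxN|case: idI].
  - exact: sub_sumsetl.
  - by case: IN; rewrite -E; apply: sub_sumsetr.
  - have : sumset N I t by rewrite E.
    by move=> [n Nn [i Ii <-]]; rewrite mulrDr (Lx _ Ii) addr0; apply: Nl.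
apply/seteqP; split=> [x /NTP Nx|x [_ /annM/NTP]//].
by split=> //; apply/annM.
Qed.

(** [J] annihilates every simple [R]-module, so it would lie in [L], against [J I = I]. *)
Lemma not_left_primitive_left_ann : ~ left_primitive_ideal R L.
Proof.
move=> [M [act [simM LE]]]; apply: complement_neq0; rewrite -jacobson_mul_complement.
apply/seteqP; split=> [|_ ->].
  apply: mulset_sub; first exact: zmod_closed0.
  move=> j i Jj; suff : L j by apply.
  by rewrite LE; split=> [|m]; [exact: jacobson_sub|exact: (jacobson_act m rR simM Jj)].
by apply: zmod0; apply: zmod_mulset; case: Jid.
Qed.

(** A maximal submodule of [I] would contain [J I], which is [I]. *)
Lemma no_maximal_left_submodule : ~ exists N, maximal_left_submodule R I N.
Proof.
move=> [N maxN]; have [[NI zN _] neqN _] := maxN; apply: neqN.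
apply/seteqP; split=> //; rewrite -{1}jacobson_mul_complement; apply: mulset_sub => // j i.
apply: jacobson_mul_maximal maxN => //; split=> // s x _; exact: Il.
Qed.

(** Every maximal [R]-submodule of [T] contains [J T], in particular [J I = I]. *)
Lemma complement_sub_left_radical : I `<=` left_radical R [set: T].
Proof.
move=> i Ii; split=> // N maxN; have [[_ zN _] _ _] := maxN.
suff : mulset J I `<=` N by rewrite jacobson_mul_complement; apply.
apply: mulset_sub => // j x Jj _; apply: jacobson_mul_maximal maxN _ _ => //.
by split=> //; apply: zmod_closedT.
Qed.

End NonRadical.

(** A maximal left ideal [N] of [R] yields the maximal submodule [N + I] of [T], so the radical
    misses [1]. *)
Lemma left_radical_neqT : left_radical R [set: T] <> [set: T].
Proof.
have sub0 : left_submodule R R [set 0].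
  split; [by move=> _ ->; apply: zmod0|exact: zmod_closed0|].
  by move=> s _ _ ->; rewrite /= mulr0.
have one0 : ~ [set 0] (1 : T).
  move=> /= T0; apply: complement_neq0; apply/seteqP; split=> [i _|_ ->]; last exact: zmod0.
  by rewrite /= -[i]mul1r T0 mul0r.
have [N maxN _] := exists_maximal_left rR sub0 one0.
have N1 := maximal_left1 rR maxN.
have [[NR zN Nl] neqN maxN'] := maxN.
have NI1 : ~ sumset N I 1.
  move=> [n Nn [i Ii E]]; apply: N1.
  suff -> : 1 = n by [].
  apply/eqP; rewrite -subr_eq0; apply/eqP; apply: complement_eq0.
    by apply: zmodB => //; [exact: subring1|exact: NR].
  by rewrite -E addrC addKr.
suff maxNI : maximal_left_submodule R [set: T] (sumset N I).
  move=> radT; apply: NI1.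
  by have : left_radical R [set: T] 1 by [rewrite radT]; case=> _; apply.
split.
- split=> //; first exact: zmod_sumset.
  move=> s _ Rs [n Nn [i Ii <-]]; rewrite mulrDr.
  by exists (s * n); [exact: Nl|exists (s * i) => //; apply: Il].
- by move=> E; apply: NI1; rewrite E.
move=> K [_ zK Kl] NIK.
have IK : I `<=` K by move=> i Ii; apply: NIK; apply: sub_sumsetr.
(* As [K] contains [I], it is determined by its trace on [R]. *)
have [||E|E] := maxN' (K `&` R).
- split; [by move=> x []|exact: zmod_closedI|].
  by move=> s x Rs [Kx Rx]; split; [exact: Kl|exact: subringM].
- by move=> n Nn; split; [apply: NIK; apply: sub_sumsetl|apply: NR].
- left; apply/seteqP; split=> // x Kx.
  have [r [i [Rr Ii xE]]] := complement_decomp x.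
  exists r; last by exists i.
  rewrite -E; split=> //; have -> : r = x - i by rewrite xE addrK.
  by apply: zmodB => //; apply: IK.
- right; apply/seteqP; split=> // x _.
  have [r [i [Rr Ii ->]]] := complement_decomp x.
  apply: zmodD => //; last exact: IK.
  by rewrite -E in Rr; case: Rr.
Qed.

End Complement.

(** * The dichotomy *)

Theorem theorem3p9 (T : pzRingType) (R I : set T)
  (maxR : maximal_subring R)
  (idI : ideal [set: T] I)
  (defT : direct_sum R I [set: T]) :
  jacobson [set: T] `&` R = jacobson R
  \/
  ((* (1) *)
   mulset I I = I
   /\
   (* (2) *)
   [/\ jacobson [set: T] `<=` conductor R,
       conductor R = left_conductor R
     & left_conductor R = right_conductor R]
   /\
   (* (3) *)
   [/\ mulset [set: T] (jacobson R) = mulset (jacobson R) [set: T],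
       ~ mulset (jacobson R) [set: T] `<=` R,
       ~ left_primitive_ideal R (conductor R),
       ~ right_primitive_ideal R (conductor R)
     & (1%:E <= krull_dim R)%E]
   /\
   [/\ mulset I (jacobson R) = mulset (jacobson R) I,
       mulset (jacobson R) I = I,
       ~ (exists N, maximal_left_submodule R I N)
     & ~ (exists N, maximal_right_submodule R I N)]
   /\
   (* (4) *)
   [/\ left_submodule R [set: T] (left_radical R [set: T]),
       left_radical R [set: T] <> [set: T]
     & I `<=` left_radical R [set: T]]
   /\
   [/\ right_submodule R [set: T] (right_radical R [set: T]),
       right_radical R [set: T] <> [set: T]
     & I `<=` right_radical R [set: T]]
   /\
   (* (5) *)
   [/\ conductor R = left_ann I,
       primitive_ideal [set: T] (conductor R)
     & minimal_prime_ideal [set: T] (conductor R)]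
   /\
   (* (6) *)
   [/\ ~ maximal_ideal [set: T] (conductor R),
       direct_sum (conductor R) I (sumset (conductor R) I),
       prime_ideal [set: T] (sumset (conductor R) I),
       ~ maximal_ideal [set: T] (sumset (conductor R) I)
     & (2%:E <= krull_dim [set: T])%E]
   /\
   (* (7) *)
   (forall M, maximal_ideal [set: T] M -> I `<=` M)
   /\
   (* (8) *)
   (forall I1, ideal [set: T] I1 -> I1 <> [set 0] -> I1 <> [set: T] ->
      R `&` I1 = [set 0] -> I1 = I)).
Proof.
have rR := maximal_subring_subring maxR.
have rT := subringT T.
(* The inclusion of the radical of [R] in that of [T] decides between the alternatives. *)
have [nJ|nJ] := pselect (jacobson R `<=` jacobson [set: T]); [left|right].
  apply/seteqP; split; first exact: (jacobsonT_sub maxR idI defT).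
  by move=> x Jx; split; [exact: nJ|exact: jacobson_sub].
have zI : GRing.zmod_closed [in I] by case: idI => -[].
have CL := conductor_left_ann maxR idI defT nJ.
have LC := right_conductor_left_ann maxR idI defT nJ.
have maxRc : @maximal_subring T^c R by rewrite maximal_subring_converse.
have idIc : @ideal T^c [set: T] I by rewrite ideal_converse.
have defTc : @direct_sum T^c R I [set: T] by exact: defT.
have nJc : ~ @jacobson T^c R `<=` @jacobson T^c [set: T].
  by rewrite (jacobson_converse rR) (jacobson_converse rT).
have CLc := @conductor_left_ann T^c _ _ maxRc idIc defTc nJc.
have LCc := @right_conductor_left_ann T^c _ _ maxRc idIc defTc nJc.
(* The two-sided conductor is the same in the converse ring, so [CL] and [CLc] identify the left and
   the right annihilator of [I]. *)
have condc : @conductor T^c R = conductor R.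
  apply/seteqP; split=> x Cx t u; first by rewrite -mulrA; apply: Cx.
  by have := Cx u t; rewrite -mulrA.
rewrite condc in CLc.
have lcond : left_conductor R = conductor R by rewrite CLc -LCc.
have [M [maxM primeM LM]] := exists_maximal_ideal_left_ann maxR idI defT nJ.
have idL := ideal_left_ann idI.
have [_ zL _ _] := (iffLR (idealP _ _)) idL.
have LR := left_ann_sub maxR idI defT nJ.
have LLI : left_ann I `<=` sumset (left_ann I) I by apply: sub_sumsetl.
have [idM neqM _] := maxM; have [MR zM _ _] := (iffLR (idealP _ _)) idM.
have primeLI : prime_ideal [set: T] (sumset (left_ann I) I).
  by apply: (prime_ideal_lift maxR idI defT); exact: (prime_left_ann maxR idI defT nJ).
have primeMI := prime_ideal_lift maxR idI defT primeM.
have nLIL : ~ sumset (left_ann I) I `<=` left_ann I.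
  move=> LIL; apply: (complement_not_sub maxR idI defT) => i Ii.
  by apply: LR; apply: LIL; apply: sub_sumsetr.
have LI_MI : sumset (left_ann I) I `<=` sumset M I.
  by move=> _ [l Ll [i Ii <-]]; exists l; [case: LM => + _; apply|exists i].
have nMI_LI : ~ sumset M I `<=` sumset (left_ann I) I.
  move=> MILI; case: LM => _; apply=> m Mm.
  have [l Ll [i Ii mE]] := MILI m (sub_sumsetl zI Mm).
  suff -> : m = l by [].
  apply/eqP; rewrite -subr_eq0; apply/eqP; apply: (complement_eq0 defT).
    by apply: zmodB; [exact: subring_zmod|exact: MR|exact: LR].
  by rewrite -mE addrC addKr.
have maxL : ~ maximal_ideal [set: T] (left_ann I).
  move=> [_ _ maxL]; have [idLI neqLI _] := primeLI.
  by have [E|E] := maxL _ idLI LLI; [rewrite E in nLIL; apply: nLIL|apply: neqLI].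
have L_I0 x : left_ann I x -> I x -> x = 0.
  by move=> /LR Rx; apply: (complement_eq0 defT).
rewrite lcond LC CL.
split; first exact: (complement_idempotent maxR idI defT nJ).
split.
  by split=> //; exact: (jacobsonT_sub_left_ann maxR idI defT nJ).
split.
  split.
  - by rewrite (mulTJ maxR idI defT nJ) (mulJT maxR idI defT nJ).
  - move=> JTR; apply: (complement_not_sub maxR idI defT) => i Ii; apply: JTR.
    by rewrite (mulJT maxR idI defT nJ); apply: sub_sumsetr => //;
      case: (ideal_jacobson rR) => -[].
  - exact: (not_left_primitive_left_ann maxR idI defT nJ).
  - rewrite -left_primitive_ideal_converse -CL CLc.
    exact: (@not_left_primitive_left_ann T^c _ _ maxRc idIc defTc nJc).
  (* The chain is [L < M], with [M] a maximal ideal of [R]. *)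
  - apply: (@prime_chain_krull_dim T R 1 (fun n => if n is 0 then left_ann I else M)).
    split=> [[|i] _|[|i] //]; last exact: primeM.
    exact: (prime_left_ann maxR idI defT nJ).
split.
  split.
  - by rewrite (complement_mul_jacobson maxR idI defT nJ)
      (jacobson_mul_complement maxR idI defT nJ).
  - exact: (jacobson_mul_complement maxR idI defT nJ).
  - exact: (no_maximal_left_submodule maxR idI defT nJ).
  - rewrite -maximal_left_submodule_converse.
    exact: (@no_maximal_left_submodule T^c _ _
      maxRc idIc defTc nJc).
split.
  split; [|exact: (left_radical_neqT maxR idI defT)|
    exact: (complement_sub_left_radical maxR idI defT nJ)].
  by apply: left_radical_submodule; split=> //; apply: zmod_closedT.
split.
  rewrite -left_radical_converse -left_submodule_converse.
  split; [|exact: (@left_radical_neqT T^c _ _ maxRc idIc defTc)|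
    exact: (@complement_sub_left_radical T^c _ _ maxRc idIc defTc nJc)].
  by apply: (@left_radical_submodule T^c); split=> //; apply: zmod_closedT.
split.
  split=> //; last exact: (minimal_prime_left_ann maxR idI defT nJ).
  split; first exact: (left_primitive_left_ann maxR idI defT nJ).
  rewrite -left_primitive_ideal_converse -CL CLc.
  exact: (@left_primitive_left_ann T^c _ _ maxRc idIc defTc nJc).
split.
  split=> //.
  - split=> //; apply/seteqP; split=> [x [Lx Ix]|_ ->]; first exact: L_I0.
    by split; apply: zmod0.
  - move=> [_ _ maxLI]; have [idMI neqMI _] := primeMI.
    by have [E|E] := maxLI _ idMI LI_MI; [rewrite E in nMI_LI; apply: nMI_LI|apply: neqMI].
  (* The chain is [L < L + I < M + I]. *)
  - apply: (@prime_chain_krull_dim T [set: T] 2 (fun n =>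
      if n is n'.+1 then if n' is 0 then sumset (left_ann I) I else sumset M I
      else left_ann I)).
    split=> [[|[|i]] _ //|[|[|i]] //].
    exact: (prime_left_ann maxR idI defT nJ).
split.
  move=> N maxN; have [idN neqN _] := maxN.
  (* If [N] meets [I] in [0], then [N I = 0], so [N] lies in [L] and equals it by maximality; but
     [L] is not maximal. *)
  have [NI0|//] := ideal_dichotomy maxR idI defT idN.
  case: maxL; suff <- : N = left_ann I by [].
  have [_ zN Nl Nr] := (iffLR (idealP _ _)) idN.
  have [_ _ maxN'] := maxN.
  have NL : N `<=` left_ann I.
    move=> x Nx i Ii; apply: NI0; first exact: Nr.
    by case: idI => -[_ _ Il] _; apply: Il.
  have [//|E] := maxN' _ idL NL.
  by case: (left_ann_not1 maxR idI defT); rewrite E.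
move=> I1 idI1 I1n0 _ RI1.
have [_ zI1 I1l I1r] := (iffLR (idealP _ _)) idI1.
(* If [I1] meets [I] in [0], it kills [I], so it lies in [L], hence in [R], and is zero. Otherwise
   it contains [I], and the [R]-component of any of its elements lies in both [R] and [I1]. *)
have [I1I0|II1] := ideal_dichotomy maxR idI defT idI1.
  case: I1n0; apply/seteqP; split=> [x I1x|_ ->]; last exact: zmod0.
  rewrite -RI1; split=> //; apply: LR => i Ii; apply: I1I0; first exact: I1r.
  by case: idI => -[_ _ Il] _; apply: Il.
apply/seteqP; split=> // x I1x.
have [r [i [Rr Ii xE]]] := complement_decomp defT x.
have : (R `&` I1) r.
  by split=> //; have -> : r = x - i; [rewrite xE addrK|apply: zmodB => //; apply: II1].
by rewrite RI1 xE => ->; rewrite add0r.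
Qed.
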